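(* Let $\Lambda\subset\mathbb{S}^n$ be a closed set. Any uniformly distributed set $X$ of bounded type in $H(\Lambda)$ satisfies $P^{\Delta}(X,o)=\infty$ for $\Delta=\Delta(X)$.
   Context: Let $n\ge1$. $(\mathbb{B}^{n+1},d)$ is the unit ball model of hyperbolic space with origin $o$ and boundary at infinity $\mathbb{S}^n$; $B_R(z)$ is the hyperbolic ball of centre $z$ and radius $R$, $\#$ is cardinality. For a closed $\Lambda\subset\mathbb{S}^n$, the convex hull $H(\Lambda)\subset\mathbb{B}^{n+1}$ is the hyperbolic convex hull of the union of all geodesics with both end points in $\Lambda$. A discrete set $X\subset H(\Lambda)$ is uniformly distributed if (i) there is $M<\infty$ such that every $z\in H(\Lambda)$ has some $x\in X$ with $d(x,z)\le M$, and (ii) there is $m>0$ with $d(x,x')\ge m$ for all distinct $x,x'\in X$. Put $P^s(X,z)=\sum_{x\in X}e^{-s\,d(x,z)}$ and $\Delta(X)=\inf\{s>0:P^s(X,z)<\infty\}$ (independent of $z\in\mathbb{B}^{n+1}$). $X$ is of bounded type if, assuming $o\in X$, there is a constant $\rho\ge1$ such that $\#(X\cap B_R(x))\le\rho\,\#(X\cap B_R(o))$ for all $x\in X$ and all $R>0$. *)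

(* Defs.v *)
From HB Require Import structures.
From mathcomp Require Import all_boot all_order all_algebra.
From mathcomp Require Import all_classical all_reals all_analysis.

Set Implicit Arguments.
Unset Strict Implicit.
Unset Printing Implicit Defensive.

Import Order.TTheory GRing.Theory Num.Theory.
Import numFieldNormedType.Exports.

Local Open Scope classical_set_scope.
Local Open Scope ring_scope.

(* Unit ball model of hyperbolic (n+1)-space, inside 'rV[R]_n.+1.  The library
   norm `|x| on row vectors is the sup norm, so the Euclidean one is spelt
   out; both induce the same topology. *)
Section ball_model.
Variables (R : realType) (n : nat).
Local Notation V := 'rV[R]_n.+1.
Implicit Types (x y z : V) (A X Lam : set V) (g : R -> V) (s r : R).

Definition sqnorm x : R := \sum_i x 0 i ^+ 2.

Definition hspace : set V := [set x | sqnorm x < 1].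

Definition bdsphere : set V := [set x | sqnorm x = 1].

Definition arcosh (t : R) : R := ln (t + Num.sqrt (t ^+ 2 - 1)).

(* Distance of the metric 2|dx| / (1 - |x|^2), of constant curvature -1; only
   meaningful on hspace. *)
Definition hdist x y : R :=
  arcosh (1 + 2 * sqnorm (x - y) / ((1 - sqnorm x) * (1 - sqnorm y))).

Definition hball z r : set V := [set w | hspace w /\ hdist z w < r].

Definition geodesic_on (I : set R) g : Prop :=
  (forall t, I t -> hspace (g t)) /\
  (forall t u, I t -> I u -> hdist (g t) (g u) = `|t - u|).

Definition geodesic_segment x y A : Prop :=
  exists l g, [/\ 0 <= l, geodesic_on `[0, l] g, g 0 = x, g l = y
    & A = g @` `[0, l]].

(* The end points are limits in the Euclidean topology of the closed ball. *)
Definition geodesic_line (xi eta : V) A : Prop :=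
  exists g, [/\ geodesic_on setT g,
    g t @[t --> -oo] --> xi, g t @[t --> +oo] --> eta & A = range g].

Definition hconvex A : Prop :=
  A `<=` hspace /\
  forall x y S, A x -> A y -> geodesic_segment x y S -> S `<=` A.

Definition hconvex_hull A : set V := smallest hconvex A.

Definition limit_hull Lam : set V :=
  hconvex_hull [set z | exists xi eta S,
    [/\ Lam xi, Lam eta, geodesic_line xi eta S & S z]].

Definition discrete_subset X : Prop := X `<=` isolated X.

Definition uniformly_distributed Lam X : Prop :=
  [/\ X `<=` limit_hull Lam, discrete_subset X,
    exists M : R, forall z, limit_hull Lam z -> exists2 x, X x & hdist x z <= M
  & exists2 m : R, 0 < m &
      forall x x', X x -> X x' -> x <> x' -> m <= hdist x x'].

Definition poincare_series s X z : \bar R :=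
  \esum_(x in X) (expR (- s * hdist x z))%:E.

(* The critical exponent does not depend on the base point, taken here to be
   the origin.  [inf] of the empty set is 0 in the library, but the set below
   is nonempty (it contains every s > n) when X is uniformly distributed. *)
Definition critical_exponent X : R :=
  inf [set s | 0 < s /\ (poincare_series s X 0 < +oo)%E].

(* Bounded type is defined for sets normalized so as to contain the origin;
   the normalization is part of the predicate, otherwise every set missing
   the origin, such as the empty one, would qualify vacuously. *)
Definition bounded_type X : Prop :=
  X 0 /\
  exists2 rho : R, 1 <= rho & forall x r, X x -> 0 < r ->
    (counting (X `&` hball x r) <= rho%:E * counting (X `&` hball 0 r))%E.

End ball_model.

Arguments hspace {R n}.
Arguments bdsphere {R n}.

(* Main.v *)
(* Let N r count the points of X in the ball of radius r about o.  A geodesic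
   from o to a point of X stays in the hull, hence within M of X; cutting it at
   the right place and using bounded type gives the submultiplicativity
   N (r + s) <= rho * N (r + M) * N (s + M).

   Suppose that the series converges at the critical exponent D > 0.  Its tails
   are small, so N r * exp (- D * r) tends to 0, hence
   q = rho * N (t + 2M) < exp (D * t) for some t.  Submultiplicativity turns
   this into N (k * t) <= q ^ k, so the series already converges at some s < D,
   a contradiction.  At D = 0 the series counts X, which is infinite because
   the hull contains a geodesic line. *)

Require Import Defs.
From mathcomp Require Import all_boot all_order all_algebra.
From mathcomp Require Import all_classical all_reals all_analysis.
From mathcomp Require Import finmap ring lra.

Set Implicit Arguments.
Unset Strict Implicit.
Unset Printing Implicit Defensive.

Import Order.TTheory GRing.Theory Num.Theory.
Import numFieldNormedType.Exports.

Local Open Scope classical_set_scope.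
Local Open Scope ring_scope.

(** Convergence of a series of positive terms, phrased through its finite partial sums so that the
    counting below stays within the reals. *)
Definition exp_summable (R : realType) (T : choiceType) (X : set T)
    (h : T -> R) (s : R) : Prop :=
  exists K : R, forall F : {fset T}, (forall x, x \in F -> X x) ->
    \sum_(x <- F) expR (- s * h x) <= K.

(** * Counting points in balls, for an abstract distance function *)

Section ball_counting.
Variables (R : realType) (T : choiceType) (X : set T) (d : T -> T -> R) (o : T).
Variables (rho M : R) (A : R -> {fset T}).
Hypothesis rho_ge1 : 1 <= rho.
Hypothesis M_ge0 : 0 <= M.
Hypothesis Xo : X o.
Hypothesis doo : d o o = 0.
Hypothesis d_ge0 : forall x, X x -> 0 <= d o x.
Hypothesis inA : forall (r : R) x, (x \in A r) <-> (X x /\ d o x < r).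
Hypothesis A_bounded_type : forall x (r : R) (F : {fset T}), X x -> 0 < r ->
  (forall y, y \in F -> X y /\ d x y < r) ->
  #|` F|%:R <= rho * #|` A r|%:R.
Hypothesis A_split : forall (r s : R) x, 0 < r -> 0 < s -> X x ->
  d o x < r + s ->
  exists y, [/\ X y, d o y < r + M & d y x < s + M].

Local Notation N r := (#|` A r|%:R : R).

(** By [A_split], the balls of radius [s + M] about the points of [A (r + M)] cover [A (r + s)];
    bounded type bounds the count in each of them by [rho * N (s + M)]. *)
Lemma count_submul (r s : R) : 0 < r -> 0 < s ->
  N (r + s) <= rho * N (r + M) * N (s + M).
Proof.
move=> r0 s0.
pose B y := [fset x in A (r + s) | (d y x < s + M)%R]%fset.
have le1 : (#|` A (r + s)| <= \sum_(y <- A (r + M)) #|` B y|)%N.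
  have -> : (\sum_(y <- A (r + M)) #|` B y| =
      \sum_(x <- A (r + s)) \sum_(y <- A (r + M)) ((d y x < s + M)%R : nat))%N.
    rewrite exchange_big /=; apply: eq_bigr => y _.
    by rewrite card_fset_sum1 big_fset /= big_mkcond.
  rewrite card_fset_sum1 big_seq [leqRHS]big_seq; apply: leq_sum => x.
  move=> /inA[Xx dx]; have [y [Xy dy dyx]] := A_split r0 s0 Xx dx.
  have yA : y \in A (r + M) by apply/inA.
  by rewrite (big_fsetD1 y) //= dyx.
apply: (@le_trans _ _ (\sum_(y <- A (r + M)) rho * N (s + M))); last first.
  by rewrite big_const_seq count_predT iter_addr addr0 -[leLHS]mulr_natr mulrAC.
move: le1; rewrite -(ler_nat R) => /le_trans; apply.
rewrite natr_sum big_seq [leRHS]big_seq; apply: ler_sum => y /inA[Xy _].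
apply: (A_bounded_type Xy); first by rewrite ltr_wpDr.
move=> x; rewrite !inE /= => /andP[/inA[Xx _] dyx].
by split.
Qed.

(** Induction with [count_submul] at the radii [k.+1%:R * t + M] and [t + M]. The slack [M + M] and
    the factor [rho] on the left are what makes the bound reproduce itself. *)
Lemma count_pow (t : R) k : 0 < t ->
  rho * N (k.+1%:R * t + M + M) <= (rho * N (t + M + M)) ^+ k.+1.
Proof.
move=> t0; elim: k => [|k IH]; first by rewrite mul1r expr1.
have rho0 : 0 <= rho by rewrite (le_trans _ rho_ge1).
have -> : k.+2%:R * t + M + M = (k.+1%:R * t + M) + (t + M).
  by rewrite -[k.+2%:R]natr1; ring.
rewrite exprSr; apply: (@le_trans _ _
   ((rho * N (k.+1%:R * t + M + M)) * (rho * N (t + M + M)))).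
  rewrite [leRHS]mulrCA ler_wpM2l //.
  by apply: count_submul; rewrite ltr_wpDr // mulr_gt0 // ltr0n.
by apply: ler_wpM2r => //; rewrite mulr_ge0.
Qed.

Lemma count_mono (r s : R) : r <= s -> N r <= N s.
Proof.
move=> rs; rewrite ler_nat; apply: fsubset_leq_card; apply/fsubsetP => x.
by move=> /inA[Xx dx]; apply/inA; split => //; apply: lt_le_trans rs.
Qed.

(** Cut [X] into shells of width [t]. By [count_pow] the shell of index [k] contributes at most
    [q ^+ k.+1 * expR (- (s * (k%:R * t)))], that is [q * th ^+ k], a geometric series of ratio
    [th < 1]. *)
Lemma exp_summable_of_count (t s : R) : 0 < t -> 0 < s ->
  rho * N (t + M + M) < expR (s * t) ->
  exp_summable X (d o) s.
Proof.
move=> t0 s0; set q := rho * _ => qs.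
have rho0 : 0 <= rho by rewrite (le_trans _ rho_ge1).
have q0 : 0 <= q by rewrite mulr_ge0.
pose th := q * expR (- (s * t)).
have th0 : 0 <= th by rewrite mulr_ge0 // expR_ge0.
have th1 : th < 1 by rewrite /th expRN ltr_pdivrMr ?expR_gt0 // mul1r.
exists (q / (1 - th)) => F FX.
(* A crude number of shells exhausting [F]; the final bound does not depend on it. *)
have [K HK] : exists K : nat, forall x, x \in F -> d o x < K%:R * t.
  exists (\sum_(x <- F) (Num.truncn (d o x / t)).+1)%N => x xF.
  rewrite -ltr_pdivrMr // (lt_le_trans (truncnS_gt _)) // ler_nat.
  by rewrite (big_fsetD1 x) //= leq_addr.
have term x : x \in F -> expR (- s * d o x) <=
    \sum_(k < K) (x \in A (k.+1%:R * t))%:R * expR (- (s * (k%:R * t))).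
  move=> xF; have Xx := FX _ xF; have dx := d_ge0 Xx.
  have dt0 : 0 <= d o x / t by rewrite divr_ge0 // ltW.
  have /andP[k1 k2] := truncn_itv dt0.
  have kK : (Num.truncn (d o x / t) < K)%N.
    by rewrite -(ltr_nat R) (le_lt_trans k1) // ltr_pdivrMr // HK.
  rewrite (bigD1 (Ordinal kK)) //=.
  have -> : x \in A ((Num.truncn (d o x / t)).+1%:R * t).
    by apply/inA; split => //; rewrite -ltr_pdivrMr.
  rewrite mul1r -[leLHS]addr0; apply: lerD.
    rewrite ler_expR mulNr lerN2 ler_wpM2l ?(ltW s0) // -ler_pdivlMr //.
  by apply: sumr_ge0 => k _; rewrite mulr_ge0 // expR_ge0.
apply: (@le_trans _ _ (\sum_(k < K) q * th ^+ k)); last first.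
  rewrite -mulr_sumr ler_wpM2l // -[leRHS]div1r ler_pdivlMr ?subr_gt0 //.
  by have := subrX1 th K; have := exprn_ge0 K th0; lra.
rewrite big_seq; apply: (le_trans (ler_sum _ term)).
rewrite -big_seq exchange_big; apply: ler_sum => k _ /=.
rewrite -mulr_suml.
have -> : q * th ^+ k = q ^+ k.+1 * expR (- (s * (k%:R * t))).
  rewrite exprS exprMn -expRM_natl -mulrA; congr (_ * (_ * expR _)).
  by rewrite mulrN; congr (- _); ring.
rewrite ler_wpM2r ?expR_ge0 //; apply: le_trans (count_pow k t0).
have : N (k.+1%:R * t) <= N (k.+1%:R * t + M + M).
  by apply: count_mono; rewrite -addrA lerDl addr_ge0.
move=> h; apply: (@le_trans _ _ (N (k.+1%:R * t + M + M))); last first.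
  by rewrite ler_peMl.
apply: le_trans h; rewrite -natr_sum ler_nat.
apply: (@leq_trans #|` [fset x in F | x \in A (k.+1%:R * t)%R]%fset|).
  by rewrite card_fset_sum1 big_fset /= [leqRHS]big_mkcond.
apply/fsubset_leq_card/fsubsetP => x.
by rewrite !inE => /andP[].
Qed.

(** Convergence at [D] yields one [t] with [rho * N (t + M + M) < expR (D * t)]. The inequality is
    strict, so it survives a small decrease of [D], and [exp_summable_of_count] applies. *)
Lemma exp_summable_lower D : 0 < D -> exp_summable X (d o) D ->
  exists s, [/\ 0 < s, s < D & exp_summable X (d o) s].
Proof.
move=> D0 [K HK].
pose fam := [set y : R | exists2 F : {fset T}, (forall x, x \in F -> X x) &
  y = \sum_(x <- F) expR (- D * d o x)].
have fam_sup : has_sup fam.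
  split; first by exists (\sum_(x <- fset0) expR (- D * d o x)); exists fset0.
  by exists K => _ [F FX ->]; apply: HK.
have rho0 : 0 < rho by rewrite (lt_le_trans _ rho_ge1).
(* Chosen so that [rho * e * expR (D * (t + M + M))] is a quarter of [expR (D * t)]. *)
pose e := (4 * rho * expR (D * (M + M)))^-1.
have e0 : 0 < e by rewrite invr_gt0 !mulr_gt0 // expR_gt0.
have [_ [F0 F0X ->] F0sup] := sup_adherent e0 fam_sup.
(* Removing the finitely many points that carry all but [e] of the sum, each
   remaining point of the ball of radius [r] weighs at least [exp (- D * r)]. *)
have countN r : N r <= #|` F0|%:R + e * expR (D * r).
  have -> : N r = #|` (A r `&` F0)%fset|%:R + #|` (A r `\` F0)%fset|%:R :> R.
    by rewrite -natrD cardfsID.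
  apply: lerD; first by rewrite ler_nat fsubset_leq_card // fsubsetIr.
  have : \sum_(x <- (F0 `|` A r)%fset) expR (- D * d o x) <= sup fam.
    apply: ub_le_sup; first exact: fam_sup.2.
    exists (F0 `|` A r)%fset => // x; rewrite inE => /orP[/F0X//|/inA[]//].
  rewrite (big_fsetID _ (mem F0)) /=.
  have -> : [fset x in F0 `|` A r | x \in F0]%fset = F0.
    by apply/fsetP => x; rewrite !inE /=; case: (x \in F0); rewrite ?andbF.
  have -> : [fset x in F0 `|` A r | x \notin F0]%fset = (A r `\` F0)%fset.
    by apply/fsetP => x; rewrite !inE /=; case: (x \in F0);
      rewrite ?andbF ?andbT.
  move=> le_sup.
  rewrite -ler_pdivrMr ?expR_gt0 // -expRN.
  apply: (@le_trans _ _ (\sum_(x <- (A r `\` F0)%fset) expR (- D * d o x))).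
    rewrite card_fset_sum1 natr_sum mulr_suml big_seq [leRHS]big_seq.
    apply: ler_sum => x; rewrite inE => /andP[_ /inA[_ dx]].
    by rewrite mul1r ler_expR mulNr lerN2 ler_wpM2l // ltW.
  lra.
have F0_ge0 : 0 <= #|` F0|%:R :> R by [].
pose t := 2 * rho * #|` F0|%:R / D + 1.
have t0 : 0 < t by rewrite ltr_wpDl // divr_ge0 ?(ltW D0) // !mulr_ge0 // ltW.
have qD : rho * N (t + M + M) < expR (D * t).
  have := ler_wpM2l (ltW rho0) (countN (t + M + M)).
  move=> /le_lt_trans; apply.
  have -> : expR (D * (t + M + M)) = expR (D * t) * expR (D * (M + M)).
    by rewrite -expRD; congr expR; ring.
  have h : 2 * rho * #|` F0|%:R + D < expR (D * t).
    apply: lt_le_trans (expR_ge1Dx _).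
    rewrite /t mulrDr mulr1 (mulrC D) divfK ?gt_eqF //; lra.
  have -> : rho * (#|` F0|%:R + e * (expR (D * t) * expR (D * (M + M)))) =
     rho * #|` F0|%:R + expR (D * t) / 4.
    by rewrite /e; field; rewrite !gt_eqF // expR_gt0.
  have := expR_gt0 (D * t); lra.
set q := rho * _ in qD.
(* The ball contains [o]; hence [ln q] is nonnegative and the exponent [s] below is positive. *)
have q1 : 1 <= q.
  rewrite -[1]mulr1; apply: ler_pM => //; rewrite ler1n cardfs_gt0.
  apply/fset0Pn; exists o; apply/inA; split => //; rewrite doo.
  by rewrite -addrA ltr_wpDr // addr_ge0.
have q0 : 0 < q by rewrite (lt_le_trans _ q1).
have lq : ln q < D * t by rewrite -(expRK (D * t)) ltr_ln // posrE ?expR_gt0.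
have lq0 : 0 <= ln q by rewrite ln_ge0.
(* Any exponent strictly between [ln q / t] and [D] would do; this is the midpoint. *)
pose s := (ln q / t + D) / 2.
have lqt0 : 0 <= ln q / t by rewrite divr_ge0 // ltW.
have lqtD : ln q / t < D by rewrite ltr_pdivrMr.
exists s; split; [rewrite /s; lra | rewrite /s; lra |].
apply: (exp_summable_of_count t0); first by rewrite /s; lra.
rewrite -[ltLHS]lnK ?posrE // ltr_expR -ltr_pdivrMr // /s; lra.
Qed.

End ball_counting.

(** * Gram inequalities and the Lorentz form *)

Lemma psd_discriminant (R : realFieldType) (a b c : R) :
  (forall s t, 0 <= s ^+ 2 * a + 2 * (s * t) * b + t ^+ 2 * c) ->
  b ^+ 2 <= a * c.
Proof.
move=> h.
have c0 : 0 <= c by have := h 0 1; rewrite expr0n expr1n /=; lra.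
have [c_gt0|c_le0] := ltP 0 c.
  (* Up to scaling, the minimiser in [t] for fixed [s]. *)
  have := h c (- b).
  have -> : c ^+ 2 * a + 2 * (c * - b) * b + (- b) ^+ 2 * c =
            c * (a * c - b ^+ 2) by ring.
  by rewrite pmulr_rge0 // subr_ge0.
have -> : c = 0 by lra.
rewrite mulr0.
have [->|b0] := eqVneq b 0; first by rewrite expr0n.
(* With [c = 0] the form is affine in [t]; this [t] gives it the value -1. *)
have := h 1 (- (a + 1) / (2 * b)).
have -> : c = 0 by lra.
have -> : 1 ^+ 2 * a + 2 * (1 * (- (a + 1) / (2 * b))) * b +
   (- (a + 1) / (2 * b)) ^+ 2 * 0 = -1 by field.
by move=> ?; lra.
Qed.

Section lorentz.
Variables (R : realType) (m : nat).
Local Notation V := 'rV[R]_m.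
Implicit Types v w : V.

Definition dotp v w : R := \sum_i v 0 i * w 0 i.

Lemma dotpC v w : dotp v w = dotp w v.
Proof. by apply: eq_bigr => i _; rewrite mulrC. Qed.

Lemma dotpDl v1 v2 w : dotp (v1 + v2) w = dotp v1 w + dotp v2 w.
Proof.
by rewrite -big_split; apply: eq_bigr => i _; rewrite mxE mulrDl.
Qed.

Lemma dotpZl a v w : dotp (a *: v) w = a * dotp v w.
Proof. by rewrite mulr_sumr; apply: eq_bigr => i _; rewrite mxE mulrA. Qed.

Lemma dotpDr v w1 w2 : dotp v (w1 + w2) = dotp v w1 + dotp v w2.
Proof. by rewrite dotpC dotpDl !(dotpC v). Qed.

Lemma dotpZr a v w : dotp v (a *: w) = a * dotp v w.
Proof. by rewrite dotpC dotpZl dotpC. Qed.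

Lemma dotp_ge0 v : 0 <= dotp v v.
Proof. by apply: sumr_ge0 => i _; rewrite -expr2 sqr_ge0. Qed.

Definition dotpE := (dotpDl, dotpDr, dotpZl, dotpZr).

Lemma dotp_CS v w : dotp v w ^+ 2 <= dotp v v * dotp w w.
Proof.
apply: psd_discriminant => s t.
have := dotp_ge0 (s *: v + t *: w); rewrite !dotpE (dotpC w v).
by congr (_ <= _); ring.
Qed.

(** The Lorentz form on pairs of a time coordinate and a space vector. *)
Definition lform (a : R) v b w := a * b - dotp v w.

(** The orthogonal complement of a timelike vector carries no timelike vector: Cauchy-Schwarz for
    [v] and [w] gives [r <= (r - a ^+ 2) * b ^+ 2] with [r = dotp v v]. *)
Lemma lform_orthogonal a v b w :
  lform b w b w = 1 -> lform a v b w = 0 -> a ^+ 2 <= dotp v v.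
Proof.
rewrite /lform => h1 h0.
have := dotp_CS v w; have := dotp_ge0 v; have := dotp_ge0 w.
set p := dotp w w in h1 *; set r := dotp v v; set u := dotp v w in h0 *.
move=> p0 r0.
have -> : u = a * b by lra.
have -> : p = b * b - 1 by lra.
move=> h.
have b1 : 1 <= b ^+ 2 by rewrite expr2; lra.
have : (r - a ^+ 2) * b ^+ 2 >= r.
  have -> : (r - a ^+ 2) * b ^+ 2 = r * (b * b) - (a * b) ^+ 2 by ring.
  lra.
move=> /(le_trans r0); rewrite pmulr_lge0 ?subr_ge0 //.
by rewrite (lt_le_trans ltr01).
Qed.

(** Project the two outer points onto the orthogonal complement of [(b, w)]. There the negated form
    is positive semidefinite, and the claim is the Gram inequality of the projections. *)
Lemma lform_triangle a v b w c u :
  lform a v a v = 1 -> lform b w b w = 1 -> lform c u c u = 1 ->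
  (lform a v b w * lform b w c u - lform a v c u) ^+ 2 <=
  (lform a v b w ^+ 2 - 1) * (lform b w c u ^+ 2 - 1).
Proof.
move=> ha hb hc; set A := lform a v b w; set B := lform b w c u.
apply: psd_discriminant => s t.
(* The pair [(x, z)] is the combination of the two projections with coefficients [s] and [t]. *)
pose x := s * (a - A * b) + t * (c - B * b).
pose z := s *: (v + (- A) *: w) + t *: (u + (- B) *: w).
have /(lform_orthogonal hb) : lform x z b w = 0.
  move: hb; rewrite /z /x /A /B /lform !dotpE (dotpC u w) => hb.
  have -> : dotp w w = b * b - 1 by lra.
  by ring.
rewrite -subr_ge0; congr (_ <= _).
move: ha hb hc; rewrite /z /x /A /B /lform !dotpE.
rewrite (dotpC u w) (dotpC u v) (dotpC w v) => ha hb hc.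
have -> : dotp w w = b * b - 1 by lra.
have -> : dotp v v = a * a - 1 by lra.
have -> : dotp u u = c * c - 1 by lra.
by ring.
Qed.

End lorentz.

(** * The inverse hyperbolic cosine *)

Section arcosh_theory.
Variable R : realType.
Implicit Types a b c t : R.

Lemma arcosh_ge0 a : 1 <= a -> 0 <= arcosh a.
Proof. by move=> a1; rewrite ln_ge0 // ler_wpDr // sqrtr_ge0. Qed.

(** The hypothesis gives [c <= a * b + p * q], whose right side is the addition formula for the
    hyperbolic cosine; [a * q + b * p] is the matching hyperbolic sine. *)
Lemma arcosh_le_add a b c : 1 <= a -> 1 <= b -> 1 <= c ->
  (a * b - c) ^+ 2 <= (a ^+ 2 - 1) * (b ^+ 2 - 1) ->
  arcosh c <= arcosh a + arcosh b.
Proof.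
move=> a1 b1 c1 h.
have a2 : 0 <= a ^+ 2 - 1 by rewrite subr_ge0 exprn_ege1.
have b2 : 0 <= b ^+ 2 - 1 by rewrite subr_ge0 exprn_ege1.
rewrite /arcosh; set p := Num.sqrt (a ^+ 2 - 1); set q := Num.sqrt (b ^+ 2 - 1).
have p0 : 0 <= p := sqrtr_ge0 _.
have q0 : 0 <= q := sqrtr_ge0 _.
have pE : p ^+ 2 = a ^+ 2 - 1 by rewrite sqr_sqrtr.
have qE : q ^+ 2 = b ^+ 2 - 1 by rewrite sqr_sqrtr.
have c_le : c <= a * b + p * q.
  have : `|c - a * b| <= p * q.
    rewrite -(ger0_norm (mulr_ge0 p0 q0)) -ler_sqr ?nnegrE //.
    rewrite !real_normK ?num_real //.
    by rewrite exprMn pE qE -sqrrN opprB.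
  by rewrite ler_norml => /andP[_]; lra.
rewrite -lnM ?posrE; [|lra|lra].
have cc : 0 <= c ^+ 2 - 1 by rewrite subr_ge0 exprn_ege1.
rewrite ler_ln ?posrE; last 2 first.
- by rewrite ltr_wpDr ?sqrtr_ge0; lra.
- by rewrite mulr_gt0; lra.
have -> : (a + p) * (b + q) = (a * b + p * q) + (a * q + b * p) by ring.
apply: lerD => //.
have n0 : 0 <= a * q + b * p by rewrite addr_ge0 // mulr_ge0 //; lra.
rewrite -(ger0_norm n0) -sqrtr_sqr ler_wsqrtr //.
have -> : (a * q + b * p) ^+ 2 =
    (a * b + p * q) ^+ 2 - (a ^+ 2 - p ^+ 2) * (b ^+ 2 - q ^+ 2) by ring.
rewrite pE qE.
have -> : (a ^+ 2 - (a ^+ 2 - 1)) * (b ^+ 2 - (b ^+ 2 - 1)) = 1 by ring.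
rewrite lerB // ler_pXn2r ?nnegrE //; lra.
Qed.

Lemma arcosh_expR t : arcosh ((expR t + expR (- t)) / 2) = `|t|.
Proof.
wlog t0 : t / 0 <= t => [H|].
  have [/H //|/ltW t0] := leP 0 t.
  by rewrite -normrN -H ?oppr_ge0 // opprK addrC.
rewrite ger0_norm //.
have e : expR t * expR (- t) = 1 by rewrite -expRD subrr expR0.
have -> : arcosh ((expR t + expR (- t)) / 2) =
    ln ((expR t + expR (- t)) / 2 + (expR t - expR (- t)) / 2).
  rewrite /arcosh; congr (ln (_ + _)).
  have -> : ((expR t + expR (- t)) / 2) ^+ 2 - 1 =
            ((expR t - expR (- t)) / 2) ^+ 2 + (expR t * expR (- t) - 1).
    by field.
  rewrite e subrr addr0.
  rewrite sqrtr_sqr ger0_norm // divr_ge0 // subr_ge0 ler_expR; lra.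
rewrite -[RHS]expRK; congr ln; by field.
Qed.

End arcosh_theory.

(** * Metric and radial geodesics of the ball model *)

Section ball_metric.
Variables (R : realType) (n : nat).
Local Notation V := 'rV[R]_n.+1.
Implicit Types (x y z u : V).

Lemma sqnormE x : sqnorm x = dotp x x.
Proof. by apply: eq_bigr => i _; rewrite expr2. Qed.

Lemma sqnorm_ge0 x : 0 <= sqnorm x.
Proof. by rewrite sqnormE dotp_ge0. Qed.

Lemma sqnormZ a x : sqnorm (a *: x) = a ^+ 2 * sqnorm x.
Proof. by rewrite !sqnormE !dotpE mulrA. Qed.

Lemma sqnormB x y : sqnorm (x - y) = sqnorm x + sqnorm y - 2 * dotp x y.
Proof.
rewrite !sqnormE -scaleN1r !dotpE (dotpC y x); ring.
Qed.

Lemma sqnorm0 : sqnorm (0 : V) = 0.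
Proof. by rewrite -(scale0r (0 : V)) sqnormZ expr0n mul0r. Qed.

Lemma sqnorm_eq0 x : sqnorm x = 0 -> x = 0.
Proof.
move=> /eqP; rewrite psumr_eq0 => [/allP h|i _]; last exact: sqr_ge0.
apply/rowP => i; rewrite mxE; apply/eqP; rewrite -sqrf_eq0.
by apply: h; rewrite mem_index_enum.
Qed.

Lemma hspace0 : hspace (0 : V).
Proof. by rewrite /hspace /= sqnorm0. Qed.

Definition coshd x y : R :=
  1 + 2 * sqnorm (x - y) / ((1 - sqnorm x) * (1 - sqnorm y)).

Lemma coshd_ge1 x y : hspace x -> hspace y -> 1 <= coshd x y.
Proof.
move=> hx hy; rewrite lerDl divr_ge0 // ?mulr_ge0 ?sqnorm_ge0 //.
  by rewrite subr_ge0 ltW.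
by rewrite subr_ge0 ltW.
Qed.

(* The isometry of the ball onto the hyperboloid [lform = 1], which turns the
   triangle inequality into a Gram determinant inequality. *)
Definition htime x : R := (1 + sqnorm x) / (1 - sqnorm x).
Definition hvect x : V := (2 / (1 - sqnorm x)) *: x.

Lemma coshdE x y : hspace x -> hspace y ->
  coshd x y = lform (htime x) (hvect x) (htime y) (hvect y).
Proof.
rewrite /hspace /= => hx hy; rewrite /coshd /lform /htime /hvect !dotpE sqnormB.
by field; rewrite !subr_eq0 !gt_eqF.
Qed.

Lemma hyperboloid x : hspace x ->
  lform (htime x) (hvect x) (htime x) (hvect x) = 1.
Proof.
rewrite /hspace /= => hx; rewrite /lform /htime /hvect !dotpE -sqnormE.
by field; rewrite !subr_eq0 !gt_eqF.
Qed.

Lemma hdist_ge0 x y : hspace x -> hspace y -> 0 <= hdist x y.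
Proof. by move=> hx hy; apply/arcosh_ge0/coshd_ge1. Qed.

Lemma hdistC x y : hdist x y = hdist y x.
Proof.
by rewrite /hdist (mulrC (1 - sqnorm x)) !sqnormB dotpC (addrC (sqnorm x)).
Qed.

Lemma hdistxx x : hdist x x = 0.
Proof.
rewrite /hdist subrr sqnorm0 mulr0 mul0r addr0.
by rewrite /arcosh expr1n subrr sqrtr0 addr0 ln1.
Qed.

Lemma hdist_triangle y x z : hspace x -> hspace y -> hspace z ->
  hdist x z <= hdist x y + hdist y z.
Proof.
move=> hx hy hz; apply: arcosh_le_add; [exact: coshd_ge1..|].
rewrite -!/(coshd _ _) !coshdE //.
by apply: lform_triangle; exact: hyperboloid.
Qed.

(** The coefficient is tanh(t/2): for a unit vector [u] this is the unit-speed diameter in direction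
    [u]. *)
Definition radial u (t : R) : V := ((expR t - 1) / (expR t + 1)) *: u.

Lemma radial_hspace u t : sqnorm u = 1 -> hspace (radial u t).
Proof.
move=> u1; rewrite /hspace /= sqnormZ u1 mulr1.
have e0 := expR_gt0 t.
have e1 : 0 < expR t + 1 by lra.
rewrite expr_div_n ltr_pdivrMr ?mul1r ?exprn_gt0 //.
rewrite -subr_gt0.
have -> : (expR t + 1) ^+ 2 - (expR t - 1) ^+ 2 = 4 * expR t by ring.
lra.
Qed.

Lemma hdist_radial u (t s : R) : sqnorm u = 1 ->
  hdist (radial u t) (radial u s) = `|t - s|.
Proof.
move=> u1; rewrite /hdist /radial -scalerBl !sqnormZ u1 -arcosh_expR opprB.
congr arcosh; rewrite !expRD !expRN.
have et := expR_gt0 t; have es := expR_gt0 s.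
field.
have -> : (expR t + 1) ^+ 2 - (expR t - 1) ^+ 2 = 4 * expR t by ring.
have -> : (expR s + 1) ^+ 2 - (expR s - 1) ^+ 2 = 4 * expR s by ring.
by rewrite !gt_eqF //; lra.
Qed.

(** The segment is a Euclidean radius; tanh(l/2) = r gives the length [l = ln ((1 + r) / (1 - r))].
    The origin has no direction and is treated apart. *)
Lemma geodesic_segment_from0 x : hspace x ->
  exists (l : R) (g : R -> V),
    [/\ 0 <= l, geodesic_on `[0, l] g, g 0 = 0 & g l = x].
Proof.
move=> hx; have [->|x0] := eqVneq x 0.
  exists 0, (fun=> 0); split => //; split => [t _|t s]; first exact: hspace0.
  rewrite /= !in_itv /= -!eq_le => /eqP <- /eqP <-.
  by rewrite hdistxx subrr normr0.
pose r := Num.sqrt (sqnorm x).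
have s0 : 0 < sqnorm x.
  rewrite lt_def sqnorm_ge0 andbT; apply: contra x0 => /eqP h.
  by rewrite (sqnorm_eq0 h).
have r0 : 0 < r by rewrite sqrtr_gt0.
have r2 : r ^+ 2 = sqnorm x by rewrite sqr_sqrtr ?sqnorm_ge0.
have r1 : r < 1 by rewrite -sqrtr1 ltr_sqrt.
have u1 : sqnorm (r^-1 *: x) = 1.
  by rewrite sqnormZ exprVn r2 mulVf ?gt_eqF.
have e1 : 1 <= (1 + r) / (1 - r) by rewrite ler_pdivlMr; lra.
exists (ln ((1 + r) / (1 - r))), (radial (r^-1 *: x)); split.
- by rewrite ln_ge0.
- split=> [t _|t s _ _]; first exact: radial_hspace.
  exact: hdist_radial.
- by rewrite /radial expR0 subrr mul0r scale0r.
rewrite /radial lnK ?posrE ?(lt_le_trans _ e1) // scalerA.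
have -> : ((1 + r) / (1 - r) - 1) / ((1 + r) / (1 - r) + 1) / r = 1.
  field.
  by rewrite gt_eqF //=; lra.
by rewrite scale1r.
Qed.

End ball_metric.

(** * The convex hull of a limit set *)

Section limit_hull_theory.
Variables (R : realType) (n : nat).
Local Notation V := 'rV[R]_n.+1.
Implicit Types (Lam X : set V).

Lemma limit_hull_hspace Lam : limit_hull Lam `<=` hspace.
Proof.
apply: smallest_sub.
  split=> // x y S _ _ [l [g [l0 [gh _] _ _ ->]]] _ [t tl <-].
  exact: gh.
by move=> z [xi [eta [S [_ _ [g [[gh _] _ _ ->]] [t _ <-]]]]]; apply: gh.
Qed.

Lemma limit_hull_convex Lam x y (S : set V) : limit_hull Lam x ->
  limit_hull Lam y -> geodesic_segment x y S -> S `<=` limit_hull Lam.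
Proof.
move=> hx hy hS z Sz M CM.
by apply: (CM.1.2 x y S) => //; [apply: hx|apply: hy].
Qed.

(** Without any line the generating set is empty, and the empty set is convex, so the hull would be
    empty. *)
Lemma limit_hull_line Lam : limit_hull Lam !=set0 ->
  exists g : R -> V, geodesic_on setT g /\ forall t, limit_hull Lam (g t).
Proof.
move=> [z hz]; apply: contrapT => no_line.
suff : (set0 : set V) z by [].
apply: hz; split; first by split.
move=> w [xi [eta [S [Lxi Leta]]]].
move=> [g [gg gxi geta SE]] Sw; apply: no_line; exists g; split => // t.
apply: sub_gen_smallest; exists xi, eta, S; split => //.
  by exists g.
by rewrite SE; exists t.
Qed.

End limit_hull_theory.

(** * The Poincare series as a real series, and local finiteness *)

Section poincare_summability.
Variables (R : realType) (n : nat).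
Local Notation V := 'rV[R]_n.+1.
Implicit Types (X : set V) (s : R).

Lemma poincare_series_lt_pinfty X s :
  (poincare_series s X 0 < +oo)%E <-> exp_summable X (hdist 0) s.
Proof.
have sumE (F : {fset V}) :
    (\sum_(x \in [set` F]) (expR (- s * hdist x 0))%:E)%E =
    (\sum_(x <- F) expR (- s * hdist 0 x))%:E.
  rewrite fsbig_finite //= set_fsetK sumEFin; congr (_%:E).
  by apply: eq_bigr => x _; rewrite hdistC.
split=> [fin|[K HK]].
  have fn : poincare_series s X 0 \is a fin_num.
    by rewrite ge0_fin_numE // esum_ge0 // => x _; rewrite lee_fin expR_ge0.
  exists (fine (poincare_series s X 0)) => F FX.
  rewrite -lee_fin fineK // -sumE; apply: ereal_sup_ubound.
  by exists [set` F].
apply: (@le_lt_trans _ _ K%:E); last exact: ltry.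
apply: ge_ereal_sup => _ [B [Bfin BX] <-].
rewrite -(fset_setK Bfin) sumE lee_fin; apply: HK => x.
by rewrite in_fset_set // => /set_mem/BX.
Qed.

Lemma finite_of_card_bound (T : choiceType) (B : set T) (K : R) :
  (forall F : {fset T}, (forall x, x \in F -> B x) -> #|` F|%:R <= K) ->
  finite_set B.
Proof.
move=> HK; apply: contrapT => Binf.
have [F FB] := infinite_set_fset (Num.truncn K).+1 Binf.
rewrite -(ler_nat R) => /(lt_le_trans (truncnS_gt K)).
by rewrite ltNge HK.
Qed.

(** Each point of the ball weighs at least [expR (- s * r)] in a series bounded by [K]. *)
Lemma finite_sublevel X s r : 0 <= s -> exp_summable X (hdist 0) s ->
  finite_set (X `&` hball 0 r).
Proof.
move=> s0 [K HK]; apply: (@finite_of_card_bound _ _ (K * expR (s * r))) => F FB.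
rewrite -ler_pdivrMr ?expR_gt0 // -expRN.
have FX x : x \in F -> X x by move=> /FB[].
apply: le_trans (HK _ FX).
rewrite card_fset_sum1 natr_sum mulr_suml big_seq [leRHS]big_seq.
apply: ler_sum => x /FB[_ [_ dx]].
by rewrite mul1r ler_expR mulNr lerN2 ler_wpM2l // ltW.
Qed.

End poincare_summability.

(** * Nets in the hull *)

Section uniformly_distributed_theory.
Variables (R : realType) (n : nat).
Local Notation V := 'rV[R]_n.+1.
Variables (Lam X : set V) (M : R).
Hypothesis X_hull : X `<=` limit_hull Lam.
Hypothesis X0 : X 0.
Hypothesis X_net : forall z, limit_hull Lam z ->
  exists2 x, X x & hdist x z <= M.

Let X_hspace : X `<=` hspace.
Proof. by move=> x /X_hull/limit_hull_hspace. Qed.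

Lemma net_radius_ge0 : 0 <= M.
Proof.
have [x Xx] := X_net (X_hull X0); apply: le_trans.
by apply: hdist_ge0; [exact: X_hspace|exact: hspace0].
Qed.

(** A finite net would keep the hull bounded, whereas the hull contains a geodesic line. *)
Lemma net_infinite : ~ finite_set X.
Proof.
move=> Xfin; have [g [[gh gd] gL]] : exists g : R -> V,
    geodesic_on setT g /\ forall t, limit_hull Lam (g t).
  by apply: limit_hull_line; exists 0; exact: X_hull.
pose B := \sum_(x <- fset_set X) hdist 0 x.
have leB x : X x -> hdist 0 x <= B.
  move=> Xx; have xF : x \in fset_set X by rewrite in_fset_set // mem_set.
  rewrite /B (big_fsetD1 x) //= lerDl big_seq.
  apply: sumr_ge0 => y; rewrite !inE => /andP[_]; rewrite in_fset_set //.
  by move=> /set_mem/X_hspace Hy; apply: hdist_ge0 => //; exact: hspace0.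
have B0 : 0 <= B by rewrite -(hdistxx (0 : V)) leB.
have c0 : 0 <= hdist (g 0) 0 by apply: hdist_ge0; [exact: gh|exact: hspace0].
have M0 := net_radius_ge0.
pose t := B + M + hdist (g 0) 0 + 1.
have [x Xx xt] := X_net (gL t).
have hx := X_hspace Xx.
have := gd 0 t I I; rewrite sub0r normrN ger0_norm; last by rewrite /t; lra.
have := @hdist_triangle _ _ 0 (g 0) (g t) (gh 0 I) (hspace0 _ _) (gh t I).
have := @hdist_triangle _ _ x 0 (g t) (hspace0 _ _) hx (gh t I).
have := leB _ Xx.
rewrite /t; lra.
Qed.

Lemma net_split (r s : R) x : 0 < r -> 0 < s -> X x -> hdist 0 x < r + s ->
  exists y, [/\ X y, hdist 0 y < r + M & hdist y x < s + M].
Proof.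
move=> r0 s0 Xx dx; have hx := X_hspace Xx.
have [l [g [l0 gg g0 gl]]] := geodesic_segment_from0 hx.
have [gh gd] := gg.
have lI : `[0, l]%classic l by rewrite /= in_itv /= l0 lexx.
have oI : `[0, l]%classic 0 by rewrite /= in_itv /= l0 lexx.
have dl : hdist 0 x = l by rewrite -gl -{1}g0 gd // sub0r normrN ger0_norm.
rewrite dl in dx.
have rs0 : 0 < r + s by rewrite addr_gt0.
(* Cut the geodesic in the ratio [r : s]; since [l < r + s], the pieces are shorter than [r] and
   [s]. *)
pose t := l * r / (r + s).
have tr : t < r by rewrite /t ltr_pdivrMr // mulrC ltr_pM2l.
have lts : l - t < s.
  have -> : l - t = l * s / (r + s) by rewrite /t; field; rewrite gt_eqF.
  by rewrite ltr_pdivrMr // mulrC ltr_pM2l.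
have t0 : 0 <= t by rewrite divr_ge0 ?(ltW rs0) // mulr_ge0 // ltW.
have tl : t <= l.
  rewrite /t ler_pdivrMr // ler_wpM2l // lerDl; exact: ltW.
have tI : `[0, l]%classic t by rewrite /= in_itv /= t0 tl.
have Lt : limit_hull Lam (g t).
  apply: (@limit_hull_convex _ _ _ 0 x (g @` `[0, l])); [exact: X_hull..| |].
    by exists l, g.
  by exists t.
have [y Xy dy] := X_net Lt; have hy := X_hspace Xy.
exists y; split => //.
  apply: le_lt_trans (hdist_triangle (hspace0 _ _) (gh t tI) hy) _.
  rewrite (hdistC (g t)) -{1}g0 gd // sub0r normrN ger0_norm //; lra.
apply: le_lt_trans (hdist_triangle hy (gh t tI) hx) _.
by rewrite -gl gd // distrC ger0_norm ?subr_ge0 //; lra.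
Qed.

End uniformly_distributed_theory.

(** * Divergence at the critical exponent *)

Theorem corollary7p9 (R : realType) (n : nat) (hn : (1 <= n)%N)
    (Lam : set 'rV[R]_n.+1) (Lam_sphere : Lam `<=` bdsphere)
    (Lam_closed : closed Lam)
    (X : set 'rV[R]_n.+1) (X_unif : uniformly_distributed Lam X)
    (X_bounded : bounded_type X) :
  poincare_series (critical_exponent X) X 0 = +oo%E.
Proof.
have [XL _ [M X_net] _] := X_unif.
have [X0 [rho rho1 X_bt]] := X_bounded.
apply: contrapT => /eqP; rewrite -ltey => /poincare_series_lt_pinfty Dsum.
set D := critical_exponent X in Dsum.
have Xinf := net_infinite XL X0 X_net.
have X_hspace x : X x -> hspace x by move=> /XL/limit_hull_hspace.
pose E := [set s | 0 < s /\ (poincare_series s X 0 < +oo)%E].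
have E_lb : lbound E 0 by move=> s [/ltW].
have D_ge0 : 0 <= D.
  (* The infimum of the empty set is 0 by convention. *)
  have [E0|E0] := eqVneq E set0.
    by rewrite /D /critical_exponent -/E E0 inf0.
  by apply: lb_le_inf => //; apply/set0P.
have fin r : finite_set (X `&` hball 0 r) := finite_sublevel r D_ge0 Dsum.
have [D0|D_gt0] : D = 0 \/ 0 < D.
  by move: D_ge0; rewrite le_eqVlt => /orP[/eqP<-|]; [left|right].
  (* At exponent 0 every term is 1, so the partial sums count points of [X]. *)
  apply: Xinf; have [K HK] := Dsum.
  apply: (@finite_of_card_bound _ _ _ K) => F FX.
  apply: le_trans (HK _ FX); rewrite card_fset_sum1 natr_sum.
  by apply: ler_sum => x _; rewrite D0 oppr0 mul0r expR0.
have [||||s [s0 sD /poincare_series_lt_pinfty s_sum]] :=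
    @exp_summable_lower R _ X (@hdist R n) 0 rho M
      (fun r => fset_set (X `&` hball 0 r))
      rho1 (net_radius_ge0 XL X0 X_net) X0 (hdistxx 0) _ _ _ _ D D_gt0 Dsum.
- by move=> x /X_hspace; apply: hdist_ge0; exact: hspace0.
- move=> r x; rewrite in_fset_set //; split=> [/set_mem[Xx []]//|[Xx dx]].
  by apply: mem_set; split => //; split => //; exact: X_hspace.
- move=> x r F Xx r0 FB; have := X_bt x r Xx r0.
  (* An infinite ball about [x] would have its infinite count bounded by a finite one. *)
  rewrite /counting; case: asboolP => [Bfin|_]; last by rewrite asboolT.
  rewrite asboolT // -EFinM lee_fin; apply: le_trans.
  rewrite ler_nat; apply/fsubset_leq_card/fsubsetP => y /FB[Xy dxy].
  rewrite in_fset_set //; apply: mem_set; split => //.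
  by split => //; exact: X_hspace.
- by move=> r s x; exact: (net_split XL X0 X_net).
have : D <= s by apply: ge_inf; [exists 0|split].
by rewrite leNgt sD.
Qed.
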